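(* Let $G$ be a conjugation-free group such that $\beta(Gr(G))\le 1$. For $i\ge3$ let $n_i$ be the number of cyclic relations of length $i$ of $G$. Then $$\phi_3(G)\le\sum_{i\ge3} n_i\,\omega_3(i-1).$$
   Context: Lower central series: for a group $G$ put $[a,b]=a^{-1}b^{-1}ab$, $G_1=G$, $G_k=[G_{k-1},G]$ for $k\ge2$, and for finitely generated $G$ let $\phi_k(G)=\operatorname{rank}(G_k/G_{k+1})$ be the rank of the finitely generated abelian group $G_k/G_{k+1}$. Let $\omega_k(n)=\phi_k(\mathbb{F}_n)$, where $\mathbb{F}_n$ is the free group of rank $n$. Conjugation-free group: a finitely presented group $G$ is conjugation-free if it has a presentation with generators $x_1,\dots,x_n$ and relations $R_1,\dots,R_w$ such that: (1) each $R_p$ is a (conjugation-free) cyclic relation of some length $t\ge2$, i.e. of the form $$R_{p,(i_t,\dots,i_1)}:\quad x_{i_t}x_{i_{t-1}}\cdots x_{i_1}=x_{i_{t-1}}\cdots x_{i_1}x_{i_t}=\cdots=x_{i_1}x_{i_t}\cdots x_{i_2},$$ where $i_1<i_2<\dots<i_t$ are indices in $\{1,\dots,n\}$ (for $t=2$ this is the commutator relation $[x_{i_1},x_{i_2}]=e$); (2) for every pair $j_1\ne j_2$ in $\{1,\dots,n\}$ there is a unique relation $R_{p,(i_t,\dots,i_1)}$ with $\{j_1,j_2\}\subseteq\{i_1,\dots,i_t\}$; (3) for any two relations $R_{p,(i_t,\dots,i_1)}$, $R_{p',(j_s,\dots,j_1)}$ with $p\ne p'$, $|\{i_1,\dots,i_t\}\cap\{j_1,\dots,j_s\}|\le1$.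 Such a presentation is fixed as part of the data; the numbers $n_i$ and the graph $Gr(G)$ are taken with respect to it. Associated graph $Gr(G)$: it has one vertex for each multiple relation, i.e. each cyclic relation of length $t\ge3$; two vertices, corresponding to $R_{p,(i_t,\dots,i_1)}$ and $R_{p',(j_s,\dots,j_1)}$, are joined by an edge if the sets $\{i_1,\dots,i_t\}$ and $\{j_1,\dots,j_s\}$ have exactly one common index. $\beta(Gr(G))$ denotes the first Betti number of the graph $Gr(G)$. *)

(* Defs.v *)
From HB Require Import structures.
From mathcomp Require Import all_boot all_order all_algebra.
From mathcomp Require Import classical_sets.

Set Implicit Arguments.
Unset Strict Implicit.
Unset Printing Implicit Defensive.

Import GRing.Theory.

Local Open Scope classical_set_scope.
Local Open Scope group_scope.

(* The free group on 'I_n, as the set of reduced words: the letter (i, true)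
   stands for the generator x_i and (i, false) for its inverse. *)

Section FreeGroup.
Variable n : nat.

Definition letter : Type := ('I_n * bool)%type.

Definition letter_inv (a : letter) : letter := (a.1, ~~ a.2).

Definition reduced (w : seq letter) : bool :=
  sorted (fun a b : letter => b != letter_inv a) w.

Definition reduced_cons (a : letter) (w : seq letter) : seq letter :=
  if w is b :: w' then if b == letter_inv a then w' else a :: w else [:: a].

Record free_group := FreeWord {
  free_word : seq letter;
  free_wordP : reduced free_word
}.

HB.instance Definition _ := [isSub for free_word].
HB.instance Definition _ := [Choice of free_group by <:].

Lemma letter_invK : involutive letter_inv.
Proof. by case=> i b; rewrite /letter_inv /= negbK. Qed.

Lemma reduced_behead (a : letter) w : reduced (a :: w) -> reduced w.
Proof. exact: path_sorted. Qed.

Lemma reduced_consP a w : reduced w -> reduced (reduced_cons a w).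
Proof.
case: w => [//|b w] /= rbw.
case: eqP => [_|/eqP nab]; first exact: reduced_behead rbw.
by rewrite /= nab.
Qed.

Lemma reduced_consE a w : reduced (a :: w) -> reduced_cons a w = a :: w.
Proof. by case: w => [//|b w] /= /andP[/negPf->]. Qed.

Lemma reduced_consK a w :
  reduced w -> reduced_cons a (reduced_cons (letter_inv a) w) = w.
Proof.
case: w => [|b w] /= rw; first by rewrite eqxx.
case: eqP => [eqb|_]; last by rewrite /= eqxx.
move: rw; rewrite eqb letter_invK => rw.
exact: reduced_consE.
Qed.

Lemma reduced_cat_subproof u v :
  reduced v -> reduced (foldr reduced_cons v u).
Proof. by move=> rv; elim: u => [//|a u IH] /=; apply: reduced_consP. Qed.

Lemma reduced_inv_subproof u : reduced u -> reduced (rev (map letter_inv u)).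
Proof.
rewrite /reduced rev_sorted; case: u => [//|a u] /=.
elim: u a => [//|b u IH] a /= /andP[nba pu].
by rewrite IH // andbT letter_invK eq_sym.
Qed.

Definition free_one : free_group := @FreeWord [::] isT.

Definition free_mul (u v : free_group) : free_group :=
  FreeWord (reduced_cat_subproof (free_word u) (free_wordP v)).

Definition free_inv (u : free_group) : free_group :=
  FreeWord (reduced_inv_subproof (free_wordP u)).

Lemma foldr_reduced_cons a u v : reduced v ->
  foldr reduced_cons v (reduced_cons a u)
    = reduced_cons a (foldr reduced_cons v u).
Proof.
move=> rv; case: u => [//|b u] /=; case: eqP => [->|//] /=.
by rewrite reduced_consK //; apply: reduced_cat_subproof.
Qed.

Lemma free_mulA : associative free_mul.
Proof.
move=> u v w; apply: val_inj => /=.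
elim: (free_word u) => [//|a s IH] /=.
by rewrite foldr_reduced_cons ?IH //; apply: free_wordP.
Qed.

Lemma free_mul1g : left_id free_one free_mul.
Proof. by move=> u; apply: val_inj. Qed.

Lemma free_mulg1 : right_id free_one free_mul.
Proof.
case=> u ru; apply: val_inj => /=.
elim: u ru => [//|a u IH] rau /=.
by rewrite IH ?reduced_consE //; apply: reduced_behead rau.
Qed.

Lemma free_mulVg : left_inverse free_one free_inv free_mul.
Proof.
case=> u ru; apply: val_inj => /=.
elim: u ru => [//|a u IH] rau.
rewrite /= rev_cons foldr_rcons /= letter_invK eqxx.
exact/IH/(reduced_behead rau).
Qed.

Lemma free_invK : involutive free_inv.
Proof.
move=> u; apply: val_inj => /=.
by rewrite map_rev revK (mapK letter_invK).
Qed.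

Lemma free_mulgV : right_inverse free_one free_inv free_mul.
Proof. by move=> u; rewrite -{1}(free_invK u) free_mulVg. Qed.

HB.instance Definition _ := isGroup.Build free_group
  free_mulA free_mul1g free_mulg1 free_mulVg free_mulgV.

Definition free_gen (i : 'I_n) : free_group := @FreeWord [:: (i, true)] isT.

(* The homomorphism from the free group that sends x_i to x i. *)
Definition free_eval (G : groupType) (x : 'I_n -> G) (u : free_group) : G :=
  \prod_(a <- free_word u) (if a.2 then x a.1 else (x a.1)^-1).

End FreeGroup.

Section Subgroups.
Variable G : groupType.

Definition is_subgroup (H : set G) : Prop :=
  [/\ H 1, forall x y, H x -> H y -> H (x * y) & forall x, H x -> H x^-1].

Definition is_normal_subgroup (H : set G) : Prop :=
  is_subgroup H /\ forall x g, H x -> H (x ^ g).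

Definition normal_closure (A : set G) : set G := smallest is_normal_subgroup A.

(* [H, K], with MathComp's [~ a, b] = a^-1 * b^-1 * a * b *)
Definition commutator_subgroup (H K : set G) : set G :=
  smallest is_subgroup [set [~ a, b] | a in H & b in K].

(* The term G_k, indexed from G_1 = G; the index 0 is junk, with value G. *)
Fixpoint lower_central (k : nat) : set G :=
  if k is k'.+1 then
    if k' is _.+1 then commutator_subgroup (lower_central k') setT else setT
  else setT.

Definition expgz (x : G) (m : int) : G :=
  match m with Posz k => x ^+ k | Negz k => x ^- k.+1 end.

(* For B normal in A with A / B abelian and a : 'I_r -> G valued in A: the
   classes of the a i in A / B are linearly independent over Z. *)
Definition independent_mod (B : set G) (r : nat) (a : 'I_r -> G) : Prop :=
  forall m : 'I_r -> int,
    B (\prod_(i < r) expgz (a i) (m i)) -> forall i, m i = 0%R.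

Definition is_quotient_rank (A B : set G) (r : nat) : Prop :=
  (exists a : 'I_r -> G, (forall i, A (a i)) /\ independent_mod B a) /\
  (forall (s : nat) (a : 'I_s -> G),
     (forall i, A (a i)) -> independent_mod B a -> (s <= r)%N).

(* The rank of the abelian group A / B: the largest size of a family that is
   linearly independent over Z. The default 0 is only reached when there is no
   largest one, which does not happen for finitely generated A / B. *)
Definition quotient_rank (A B : set G) : nat :=
  xget 0%N [set r | is_quotient_rank A B r].

Definition lcs_rank (k : nat) : nat :=
  quotient_rank (lower_central k) (lower_central k.+1).

End Subgroups.

Definition free_lcs_rank (k n : nat) : nat := lcs_rank (free_group n) k.

(* The relation of support {i_1 < ... < i_t}. As enum lists ordinals in
   increasing order, s is i_t, ..., i_1, and its successive rotations give the
   members of the relation from left to right. *)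
Definition cyclic_relators (n : nat) (I : {set 'I_n}) : set (free_group n) :=
  let s := rev (enum I) in
  let word (t : seq 'I_n) := \prod_(i <- t) free_gen i in
  [set g | exists2 k, (k < size s)%N & g = word s / word (rot k s)].

Record conj_free_presentation (G : groupType) := ConjFreePresentation {
  cf_ngens : nat;
  cf_nrels : nat;
  cf_gen : 'I_cf_ngens -> G;
  cf_support : 'I_cf_nrels -> {set 'I_cf_ngens};
  cf_generate : forall g : G, exists u, free_eval cf_gen u = g;
  cf_relations : forall u, free_eval cf_gen u = 1 <->
    normal_closure (\bigcup_p cyclic_relators (cf_support p)) u;
  cf_length : forall p, (2 <= #|cf_support p|)%N;
  cf_pair : forall j1 j2, j1 != j2 ->
    exists! p, (j1 \in cf_support p) && (j2 \in cf_support p);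
  cf_inter : forall p q, p != q ->
    (#|cf_support p :&: cf_support q| <= 1)%N
}.

(* First Betti number of the simple graph (T, e): the dimension of
   H_1 = ker (C_1 -> C_0) over rat. An edge {u, v} is counted once, oriented
   from the vertex of smaller rank to the other; the rows of the boundary
   matrix are v - u. *)
Section Betti.
Local Open Scope ring_scope.
Variables (T : finType) (e : rel T).

Definition oriented_edges : {pred T * T} :=
  [pred uv | e uv.1 uv.2 && (enum_rank uv.1 < enum_rank uv.2)%N].

Definition boundary_mx : 'M[rat]_(#|oriented_edges|, #|T|) :=
  \matrix_(k, j) ((enum_val j == (enum_val k).2)%:R
                  - (enum_val j == (enum_val k).1)%:R).

Definition graph_betti1 : nat := \rank (kermx boundary_mx).

End Betti.

Section Graph.
Variables (G : groupType) (P : conj_free_presentation G).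

Definition multiple_relation : Type :=
  {p : 'I_(cf_nrels P) | (3 <= #|cf_support p|)%N}.

HB.instance Definition _ := Finite.on multiple_relation.

Definition relation_graph : rel multiple_relation := fun u v =>
  (u != v) && (#|cf_support (val u) :&: cf_support (val v)| == 1%N).

Definition num_relations (i : nat) : nat :=
  #|[pred p : 'I_(cf_nrels P) | #|cf_support p| == i]|.

End Graph.

Arguments relation_graph {G} P.

(* Main.v *)
Require Import Defs.
From HB Require Import structures.
From mathcomp Require Import all_boot all_order all_algebra.
From mathcomp Require Import boolp classical_sets.

(** Write [t i j k] for the class of [[x_i, x_j], x_k] in [G_3 / G_4], where the
[x_i] are the generators of the presentation. This bracket is trilinear, is
alternating in its first two arguments and satisfies the Jacobi identity, and its
values generate [G_3 / G_4] ([gr3_generated]). A cyclic relation with support [I]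
says that the product of its generators commutes with each of them, hence that
the sum over [j] in [I] of [t i j k] vanishes for [i] in [I] ([cf_triple_rel]).

Think of the supports as lines on the set of generators: two points lie on
exactly one line. The brackets are of two kinds.

If [i], [j] lie on the line [p] and [k] does not, then [t i j k] = 0
([t_nonlocal]). A generator [k] off [p] can fail to commute with a point [i] of
[p] in degree 2 only if the line through [i] and [k] is multiple. Two such lines
through [k] form, together with [p], a triangle in the graph of the presentation.
Two triangles with a common edge would give two independent cycles
([diamond_betti]), so the bound on the Betti number leaves at most one such
triangle on each edge. The sum relations and the Jacobi identity then kill the
bracket in every configuration; the case of a triangle is [t_triangle].

If [i], [j], [k] lie on one line [p] with [s] points, one of the points can be
eliminated from all brackets by the sum relations, so that the span of these
brackets is an image of the third lower central quotient of a free group on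
[s - 1] letters ([cf_local_span]). Up to a non-zero multiple it is therefore
spanned by [free_lcs_rank 3 (s - 1)] elements ([free_rank_local]).

Together, up to non-zero multiples, [G_3 / G_4] is spanned by as many elements as
the right-hand side counts, and linear algebra over the rationals bounds the size
of an independent family ([rational_span_rank]). *)

Set Implicit Arguments.
Unset Strict Implicit.
Unset Printing Implicit Defensive.

Import GRing.Theory Num.Theory.

Local Open Scope group_scope.

(** * The quotient of a group by a normal subgroup *)

Section QuotientGroup.
Local Open Scope quotient_scope.
Variable G : groupType.

Record normal_subgroup := NormalSubgroup {
  nsub_set :> G -> Prop;
  nsub_normal : is_normal_subgroup nsub_set
}.

Variable N : normal_subgroup.

Let N1 : N 1. Proof. by case: (nsub_normal N) => -[]. Qed.
Let NM x y : N x -> N y -> N (x * y).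
Proof. by case: (nsub_normal N) => -[_ H _] _; apply: H. Qed.
Let NV x : N x -> N x^-1.
Proof. by case: (nsub_normal N) => -[_ _ H] _; apply: H. Qed.
Let NJ x g : N x -> N (x ^ g).
Proof. by case: (nsub_normal N) => _ H; apply: H. Qed.

Definition coset_rel : rel G := fun x y => `[< N (x^-1 * y) >].

Lemma coset_rel_refl : reflexive coset_rel.
Proof. by move=> x; apply/asboolP; rewrite mulVg. Qed.

Lemma coset_rel_sym : symmetric coset_rel.
Proof.
by move=> x y; apply/asboolP/asboolP => /NV; rewrite invgM invgK.
Qed.

Lemma coset_rel_trans : transitive coset_rel.
Proof.
move=> y x z /asboolP Nxy /asboolP Nyz; apply/asboolP.
by have := NM Nxy Nyz; rewrite mulgA mulgK.
Qed.

Canonical coset_equiv :=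
  EquivRel coset_rel coset_rel_refl coset_rel_sym coset_rel_trans.

Definition quotient_group := {eq_quot coset_equiv}.

HB.instance Definition _ := Choice.on quotient_group.

Definition qmk (x : G) : quotient_group := \pi x.

Lemma qmkP x y : qmk x = qmk y <-> N (x^-1 * y).
Proof.
split; first by move/eqmodP => /asboolP.
by move=> H; apply/eqmodP/asboolP.
Qed.

Lemma qmk_surj (u : quotient_group) : exists x, u = qmk x.
Proof. by exists (repr u); rewrite /qmk reprK. Qed.

Definition qmul (u v : quotient_group) := qmk (repr u * repr v).
Definition qinv (u : quotient_group) := qmk (repr u)^-1.

Lemma qrepr x : N (x^-1 * repr (qmk x)).
Proof. by apply/qmkP; rewrite /qmk reprK. Qed.

Lemma qmkM_subproof x y : qmul (qmk x) (qmk y) = qmk (x * y).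
Proof.
apply/esym/qmkP.
have -> : (x * y)^-1 * (repr (qmk x) * repr (qmk y)) =
   (x^-1 * repr (qmk x)) ^ y * (y^-1 * repr (qmk y)).
  by rewrite conjgE invgM !mulgA mulgK.
by apply: NM; [apply: NJ|]; apply: qrepr.
Qed.

Lemma qmkV_subproof x : qinv (qmk x) = qmk x^-1.
Proof.
apply/qmkP; rewrite invgK.
have -> : repr (qmk x) * x^-1 = (x^-1 * repr (qmk x)) ^ x^-1.
  by rewrite conjgE invgK !mulgA mulgV mul1g.
by apply: NJ; apply: qrepr.
Qed.

Lemma qmulA : associative qmul.
Proof.
move=> u v w.
have [[x ->] [y ->] [z ->]] := And3 (qmk_surj u) (qmk_surj v) (qmk_surj w).
by rewrite !qmkM_subproof mulgA.
Qed.

Lemma qmul1g : left_id (qmk 1) qmul.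
Proof. by move=> u; have [x ->] := qmk_surj u; rewrite qmkM_subproof mul1g. Qed.

Lemma qmulg1 : right_id (qmk 1) qmul.
Proof. by move=> u; have [x ->] := qmk_surj u; rewrite qmkM_subproof mulg1. Qed.

Lemma qmulVg : left_inverse (qmk 1) qinv qmul.
Proof.
by move=> u; have [x ->] := qmk_surj u; rewrite qmkV_subproof qmkM_subproof mulVg.
Qed.

Lemma qmulgV : right_inverse (qmk 1) qinv qmul.
Proof.
by move=> u; have [x ->] := qmk_surj u; rewrite qmkV_subproof qmkM_subproof mulgV.
Qed.

HB.instance Definition _ := isGroup.Build quotient_group
  qmulA qmul1g qmulg1 qmulVg qmulgV.

Lemma qmkM : {morph qmk : x y / x * y}.
Proof. by move=> x y; rewrite -qmkM_subproof. Qed.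

HB.instance Definition _ := isUMagmaMorphism.Build G quotient_group qmk
  (conj (erefl : qmk 1 = 1) qmkM).

Lemma qmkV x : qmk x^-1 = (qmk x)^-1.
Proof. exact: gmulfV. Qed.

Lemma qmkR x y : qmk [~ x, y] = [~ qmk x, qmk y].
Proof. exact: gmulfR. Qed.

Lemma qmk_eq1 x : qmk x = 1 <-> N x.
Proof.
rewrite -[1]/(qmk 1); split; first by move/esym/qmkP; rewrite invg1 mul1g.
by move=> Nx; apply/esym/qmkP; rewrite invg1 mul1g.
Qed.

End QuotientGroup.

(** * The center of a group, written additively *)

Section Center.
Variable Q : groupType.

Definition centralb (x : Q) : bool := `[< forall y, commute x y >].

Record center := CenterElement { center_val : Q; _ : centralb center_val }.

HB.instance Definition _ := [isSub for center_val].
HB.instance Definition _ := [Choice of center by <:].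

Lemma centralP (z : center) y : commute (val z) y.
Proof. by case: z => z /= /asboolP. Qed.

Lemma central1 : centralb 1.
Proof. by apply/asboolP => y; apply/commute_sym/commute1. Qed.

Lemma centralM (x y : center) : centralb (val x * val y).
Proof.
by apply/asboolP => z; apply/commute_sym/commuteM; apply/commute_sym/centralP.
Qed.

Lemma centralV (x : center) : centralb (val x)^-1.
Proof. 
by apply/asboolP => z; apply/commute_sym/commuteV/commute_sym/centralP.
Qed.

Definition center0 := CenterElement central1.
Definition center_add x y := CenterElement (centralM x y).
Definition center_opp x := CenterElement (centralV x).

Lemma center_addA : associative center_add.
Proof. by move=> x y z; apply: val_inj; rewrite /= mulgA. Qed.
Lemma center_addC : commutative center_add.
Proof. by move=> x y; apply: val_inj; apply: centralP. Qed.
Lemma center_add0 : left_id center0 center_add.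
Proof. by move=> x; apply: val_inj; rewrite /= mul1g. Qed.
Lemma center_addN : left_inverse center0 center_opp center_add.
Proof. by move=> x; apply: val_inj; rewrite /= mulVg. Qed.

HB.instance Definition _ := GRing.isZmodule.Build center
  center_addA center_addC center_add0 center_addN.

Lemma center_valD (x y : center) : val (x + y)%R = val x * val y.
Proof. by []. Qed.
Lemma center_valN (x : center) : val (- x)%R = (val x)^-1.
Proof. by []. Qed.
Lemma center_conj (x : center) y : val x ^ y = val x.
Proof. by rewrite conjgE (centralP x y) mulKg. Qed.

End Center.

(** * Triple commutators in a group of class three *)

Section TripleCommutator.
Variable Q : groupType.
Hypothesis class3 : forall a b c d : Q, [~ [~ [~ a, b], c], d] = 1.

Lemma triple_central (a b c : Q) : centralb [~ [~ a, b], c].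
Proof. by apply/asboolP => d; apply/commgP; rewrite class3. Qed.

(** In class three the bracket [[a, b], c] is central, so it can be valued in
the additive group [center Q], where multilinearity and finite sums make sense.
This is the degree 3 bracket of the graded Lie ring of [Q]. *)
Definition triple (a b c : Q) : center Q := CenterElement (triple_central a b c).

Lemma commMg (x y z : Q) : [~ x * y, z] = [~ x, z] ^ y * [~ y, z].
Proof. by rewrite /commg /conjg !invgM !mulgA !mulgK. Qed.

Lemma commgM (x y z : Q) : [~ x, y * z] = [~ x, z] * [~ x, y] ^ z.
Proof. by rewrite /commg /conjg !invgM !mulgA !mulgK. Qed.

Lemma commVg (x y : Q) : [~ x^-1, y] = ([~ x, y]^-1) ^ x^-1.
Proof. by rewrite /commg /conjg !invgM !invgK !mulgA mulgK. Qed.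

Lemma tripleDr a b c d : triple a b (c * d) = (triple a b c + triple a b d)%R.
Proof.
apply: val_inj; rewrite center_valD /= commgM.
by rewrite (center_conj (triple a b c)) (centralP (triple a b d)).
Qed.

Lemma tripleC a b c : triple b a c = (- triple a b c)%R.
Proof.
apply: val_inj; rewrite center_valN /= -[[~ b, a]]invgR commVg.
exact: (center_conj (- triple a b c)%R).
Qed.

Lemma tripleDl a b c d : triple (a * b) c d = (triple a c d + triple b c d)%R.
Proof.
apply: val_inj; rewrite center_valD /= commMg.
have -> : [~ a, c] ^ b = [~ a, c] * [~ [~ a, c], b].
  by rewrite /commg /conjg !mulgA !mulgV !mul1g.
rewrite commMg.
have -> u : [~ u * [~ [~ a, c], b], d] = [~ u, d].
  by rewrite commMg class3 mulg1; apply/conjg_fixP; rewrite commg1_sym;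
     apply/commgP/(centralP (triple a c b)).
by rewrite (center_conj (triple a c d)).
Qed.

Lemma tripleDm a b c d : triple a (b * c) d = (triple a b d + triple a c d)%R.
Proof. by rewrite tripleC tripleDl opprD -!(tripleC _ a). Qed.

Lemma triple_1l b c : triple 1 b c = 0%R.
Proof. by apply: (addrI (triple 1 b c)); rewrite -tripleDl mulg1 addr0. Qed.
Lemma triple_1m b c : triple b 1 c = 0%R.
Proof. by rewrite tripleC triple_1l oppr0. Qed.
Lemma triple_1r b c : triple b c 1 = 0%R.
Proof. by apply: (addrI (triple b c 1)); rewrite -tripleDr mulg1 addr0. Qed.

Lemma triple_Vl a b c : triple a^-1 b c = (- triple a b c)%R.
Proof.
by apply: (addrI (triple a b c)); rewrite -tripleDl mulgV triple_1l addrN.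
Qed.
Lemma triple_Vm a b c : triple a b^-1 c = (- triple a b c)%R.
Proof. by rewrite tripleC triple_Vl -tripleC. Qed.
Lemma triple_Vr a b c : triple a b c^-1 = (- triple a b c)%R.
Proof.
by apply: (addrI (triple a b c)); rewrite -tripleDr mulgV triple_1r addrN.
Qed.

Lemma triple_alt a b : triple a a b = 0%R.
Proof. by apply: val_inj; rewrite /= commgg comm1g. Qed.

Lemma Hall_Witt (x y z : Q) :
  [~ [~ x, y^-1], z] ^ y * [~ [~ y, z^-1], x] ^ z * [~ [~ z, x^-1], y] ^ x = 1.
Proof.
rewrite /commg /conjg !invgM !invgK !mulgA.
by rewrite !(mulgK, mulgVK, mulgV, mulVg, mul1g, mulg1).
Qed.

(** The conjugations in the Hall-Witt identity act trivially on central
elements, and the inverses come out as signs. *)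
Lemma triple_Jacobi a b c :
  (triple a b c + triple b c a + triple c a b = 0)%R.
Proof.
have H : (triple a b^-1 c + triple b c^-1 a + triple c a^-1 b = 0)%R.
  apply: val_inj; have := Hall_Witt a b c.
  rewrite (center_conj (triple a b^-1 c)) (center_conj (triple b c^-1 a)).
  by rewrite (center_conj (triple c a^-1 b)).
by move/eqP: H; rewrite !triple_Vm -!opprD oppr_eq0 => /eqP.
Qed.

End TripleCommutator.

(** * The lower central series and its third quotient *)

Section LowerCentralSeries.
Local Open Scope classical_set_scope.
Variable G : groupType.

Lemma smallest_subgroup (A : set G) : is_subgroup (smallest (@is_subgroup G) A).
Proof.
split=> [|x y Hx Hy|x Hx] H [sH AH]; have [H1 HM HV] := sH.
- exact: H1.
- by apply: HM; [apply: Hx|apply: Hy].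
- by apply: HV; apply: Hx.
Qed.

Lemma commutator_subgroup_normal (H : set G) :
  is_normal_subgroup H -> is_normal_subgroup (commutator_subgroup H setT).
Proof.
move=> [_ HJ]; split; first exact: smallest_subgroup.
move=> x g Kx.
have [K1 KM KV] := smallest_subgroup [set [~ a, b] | a in H & b in setT].
pose M := [set y | commutator_subgroup H setT (y ^ g)].
apply: (Kx M); split; first split.
- by rewrite /M /= conj1g.
- by move=> y z; rewrite /M /= conjMg; apply: KM.
- by move=> y; rewrite /M /= conjVg; apply: KV.
move=> _ [a Ha [b _ <-]]; rewrite /M /= conjRg.
by apply: sub_gen_smallest; exists (a ^ g); [apply: HJ|exists (b ^ g)].
Qed.

Lemma lower_central_normal k : is_normal_subgroup (lower_central (G := G) k).
Proof.
by elim: k => [|[|k] IH] //=; apply: commutator_subgroup_normal.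
Qed.

Lemma lower_central_commg k (a b : G) :
  lower_central k.+1 a -> lower_central k.+2 [~ a, b].
Proof. by move=> Ha; apply: sub_gen_smallest; exists a => //; exists b. Qed.

Lemma lower_central_triple (a b c : G) : lower_central 3 [~ [~ a, b], c].
Proof.
have H2 : lower_central 2 [~ a, b] by apply: (@lower_central_commg 0 a b).
exact: (@lower_central_commg 1 _ c H2).
Qed.

Lemma lower_central_ind k (P : G -> Prop) :
  P 1 -> (forall a b, P a -> P b -> P (a * b)) -> (forall a, P a -> P a^-1) ->
  (forall a b, lower_central k.+1 a -> P [~ a, b]) ->
  forall g, lower_central k.+2 g -> P g.
Proof.
move=> P1 PM PV Pc g Hg; apply: (Hg P); split=> // _ [a Ha [b _ <-]].
exact: Pc.
Qed.

End LowerCentralSeries.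

Lemma lower_central_morph (G H : groupType) (f : UMagmaMorphism.type G H) k g :
  lower_central k g -> lower_central k (f g).
Proof.
elim: k g => [|[|k] IH] //.
have [[H1 HM HV] _] := lower_central_normal H k.+2.
apply: lower_central_ind => [|a b|a|a b Ha].
- by rewrite gmulf1.
- by rewrite gmulfM; apply: HM.
- by rewrite gmulfV; apply: HV.
- by rewrite gmulfR; apply: lower_central_commg; apply: IH.
Qed.

Section ThirdQuotient.
Variable G : groupType.

Definition lcs4 : normal_subgroup G := NormalSubgroup (lower_central_normal G 4).

Notation Q := (quotient_group lcs4).

Lemma lcs3_central (g : G) : lower_central 3 g -> centralb (qmk lcs4 g).
Proof.
move=> Hg; apply/asboolP => y; have [h ->] := qmk_surj y.
apply/commgP/eqP; rewrite -qmkR; apply/qmk_eq1.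
exact: lower_central_commg.
Qed.

(** [G / G_4] has class at most three, so the previous part applies to it. *)
Lemma class3 (a b c d : Q) : [~ [~ [~ a, b], c], d] = 1.
Proof.
have [[a' ->] [b' ->] [c' ->]] := And3 (qmk_surj a) (qmk_surj b) (qmk_surj c).
rewrite -!qmkR; apply/eqP/commgP.
move: d; apply/asboolP; apply: lcs3_central.
exact: lower_central_triple.
Qed.

(** The projection of [G_3] onto [G_3 / G_4], which is central in [G / G_4].
Its values outside [G_3] are junk that makes the map total. *)
Definition gr3 (g : G) : center Q := insubd (0%R : center Q) (qmk lcs4 g).

Lemma val_gr3 g : lower_central 3 g -> val (gr3 g) = qmk lcs4 g.
Proof. by move=> /lcs3_central Hg; rewrite val_insubd Hg. Qed.

Let lcs3_1 : lower_central 3 (1 : G).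
Proof. by case: (lower_central_normal G 3) => -[]. Qed.
Let lcs3_M (g h : G) :
  lower_central 3 g -> lower_central 3 h -> lower_central 3 (g * h).
Proof. by case: (lower_central_normal G 3) => -[_ H _] _; apply: H. Qed.
Let lcs3_V (g : G) : lower_central 3 g -> lower_central 3 g^-1.
Proof. by case: (lower_central_normal G 3) => -[_ _ H] _; apply: H. Qed.

Lemma gr3_1 : gr3 1 = 0%R.
Proof. by apply: val_inj; rewrite val_gr3. Qed.

Lemma gr3M g h : lower_central 3 g -> lower_central 3 h ->
  gr3 (g * h) = (gr3 g + gr3 h)%R.
Proof.
move=> Hg Hh; apply: val_inj; rewrite center_valD !val_gr3 ?qmkM //.
exact: lcs3_M.
Qed.

Lemma gr3V g : lower_central 3 g -> gr3 g^-1 = (- gr3 g)%R.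
Proof.
move=> Hg; apply: val_inj; rewrite center_valN !val_gr3 ?qmkV //.
exact: lcs3_V.
Qed.

Lemma gr3_eq0 g : lower_central 3 g -> gr3 g = 0%R <-> lower_central 4 g.
Proof.
move=> Hg; split=> [H|H].
  by apply/(qmk_eq1 lcs4); rewrite -val_gr3 // H.
by apply: val_inj; rewrite val_gr3 //; apply/(qmk_eq1 lcs4).
Qed.

Lemma gr3X g n : lower_central 3 g ->
  lower_central 3 (g ^+ n) /\ gr3 (g ^+ n) = (gr3 g *+ n)%R.
Proof.
move=> Hg; elim: n => [|n [IH1 IH2]]; first by rewrite expg0 mulr0n gr3_1.
by rewrite expgS mulrS gr3M // IH2; split=> //; apply: lcs3_M.
Qed.

Lemma gr3Z g m : lower_central 3 g ->
  lower_central 3 (expgz g m) /\ gr3 (expgz g m) = (gr3 g *~ m)%R.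
Proof.
case: m => n Hg /=; first exact: gr3X.
have [H1 H2] := gr3X n.+1 Hg.
by rewrite NegzE mulrNz gr3V // H2; split=> //; apply: lcs3_V.
Qed.

Lemma gr3_prod r (a : 'I_r -> G) (m : 'I_r -> int) :
  (forall i, lower_central 3 (a i)) ->
  lower_central 3 (\prod_(i < r) expgz (a i) (m i)) /\
  gr3 (\prod_(i < r) expgz (a i) (m i)) = (\sum_(i < r) gr3 (a i) *~ m i)%R.
Proof.
move=> Ha; elim/big_ind2: _ => [|x y g h [H1 H2] [H3 H4]|i _].
- by rewrite gr3_1.
- by split; [apply: lcs3_M|rewrite gr3M // H2 H4].
- exact: gr3Z.
Qed.

Lemma independent_mod_lcs4 r (a : 'I_r -> G) :
  (forall i, lower_central 3 (a i)) ->
  independent_mod (lower_central 4) a <->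
  forall m : 'I_r -> int, (\sum_(i < r) gr3 (a i) *~ m i = 0)%R ->
    forall i, m i = 0%R.
Proof.
move=> Ha; split=> H m Hm; apply: H.
  by have [H1 H2] := gr3_prod m Ha; apply/gr3_eq0; rewrite ?H2.
by have [H1 <-] := gr3_prod m Ha; apply/gr3_eq0.
Qed.

Definition triple3 (a b c : G) : center Q :=
  triple class3 (qmk lcs4 a) (qmk lcs4 b) (qmk lcs4 c).

Lemma triple3E a b c : triple3 a b c = gr3 [~ [~ a, b], c].
Proof.
apply: val_inj; rewrite val_gr3 ?qmkR //.
exact: lower_central_triple.
Qed.

Section Generation.
Variables (n : nat) (x : 'I_n -> G).
Hypothesis gen_x : forall g : G, exists u, free_eval x u = g.

Lemma generate_ind (P : G -> Prop) :
  P 1 -> (forall a b, P a -> P b -> P (a * b)) -> (forall a, P a -> P a^-1) ->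
  (forall i, P (x i)) -> forall g, P g.
Proof.
move=> P1 PM PV Px g; have [u <-] := gen_x g.
by apply: (big_ind P) => // -[i []] _ /=; [|apply: PV].
Qed.

Variable S : center Q -> Prop.
Hypothesis S0 : S 0%R.
Hypothesis SD : forall a b, S a -> S b -> S (a + b)%R.
Hypothesis SN : forall a, S a -> S (- a)%R.
Hypothesis Sx : forall i j k, S (triple3 (x i) (x j) (x k)).

Lemma triple3_generated a b c : S (triple3 a b c).
Proof.
move: c; apply: generate_ind => [|c d|c|k].
- by rewrite /triple3 [qmk _ 1]gmulf1 triple_1r.
- by rewrite /triple3 qmkM tripleDr; apply: SD.
- by rewrite /triple3 qmkV triple_Vr; apply: SN.
move: b; apply: generate_ind => [|c d|c|j].
- by rewrite /triple3 [qmk _ 1]gmulf1 triple_1m.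
- by rewrite /triple3 qmkM tripleDm; apply: SD.
- by rewrite /triple3 qmkV triple_Vm; apply: SN.
move: a; apply: generate_ind => [|c d|c|i].
- by rewrite /triple3 [qmk _ 1]gmulf1 triple_1l.
- by rewrite /triple3 qmkM tripleDl; apply: SD.
- by rewrite /triple3 qmkV triple_Vl; apply: SN.
exact: Sx.
Qed.

(** A subgroup of [G_3 / G_4] that contains the triple commutators of the
generators is everything: [G_3] is generated by the [[h, c]] with [h] in [G_2],
and [h] reduces to commutators since [[h, c]] is additive in [h] modulo [G_4]. *)
Lemma gr3_generated g : lower_central 3 g -> S (gr3 g).
Proof.
have lc3 (h c : G) : lower_central 2 h -> lower_central 3 [~ h, c].
  exact: lower_central_commg.
have main h c : lower_central 2 h -> S (gr3 [~ h, c]).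
  suff: lower_central 2 h -> lower_central 2 h /\ S (gr3 [~ h, c]).
    by move=> H /H [].
  have [[L1 LM LV] _] := lower_central_normal G 2.
  move: h; apply: lower_central_ind => [|h k [Hh Sh] [Hk Sk]|h [Hh Sh]|a b _].
  - by rewrite comm1g gr3_1.
  - split; first exact: LM.
    have -> : gr3 [~ h * k, c] = (gr3 [~ h, c] + gr3 [~ k, c])%R; last exact: SD.
    apply: val_inj; rewrite center_valD (val_gr3 (lc3 _ c (LM _ _ Hh Hk))).
    rewrite qmkR qmkM commMg -!qmkR -(val_gr3 (lc3 _ c Hh)) center_conj.
    by rewrite -(val_gr3 (lc3 _ c Hk)).
  - split; first exact: LV.
    have -> : gr3 [~ h^-1, c] = (- gr3 [~ h, c])%R; last exact: SN.
    apply: val_inj; rewrite center_valN (val_gr3 (lc3 _ c (LV _ Hh))).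
    rewrite qmkR qmkV commVg -!qmkR -(val_gr3 (lc3 _ c Hh)) -center_valN.
    by rewrite center_conj.
  - split; first exact: lower_central_commg.
    by rewrite -triple3E; apply: triple3_generated.
move=> Hg.
suff: lower_central 3 g /\ S (gr3 g) by case.
move: g Hg; apply: lower_central_ind => [|h k [Hh Sh] [Hk Sk]|h [Hh Sh]|a b Ha].
- by rewrite gr3_1.
- by split; [apply: lcs3_M|rewrite gr3M //; apply: SD].
- by split; [apply: lcs3_V|rewrite gr3V //; apply: SN].
- by split; [apply: lower_central_commg|apply: main].
Qed.

End Generation.
End ThirdQuotient.

(** * Rank in an abelian group *)

Section RationalSpan.
Local Open Scope ring_scope.
Variables (Z : zmodType) (J : finType) (g : J -> Z).

(** The elements that fall in the span of [g] after tensoring with the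
rationals. Allowing the multiple [d] keeps torsion out of all rank counts. *)
Definition rational_span (z : Z) : Prop :=
  exists2 d : int, d != 0 & exists m : J -> int, z *~ d = \sum_j g j *~ m j.

Lemma rational_span0 : rational_span 0.
Proof.
by exists 1 => //; exists (fun=> 0); rewrite mul0rz big1.
Qed.

Lemma rational_spanD a b :
  rational_span a -> rational_span b -> rational_span (a + b).
Proof.
move=> [d d0 [m Hm]] [e e0 [k Hk]]; exists (d * e); first by rewrite mulf_neq0.
exists (fun j => m j * e + k j * d).
rewrite mulrzDl [a *~ _]mulrzA [(d * e)%R]mulrC mulrzA Hm Hk.
rewrite !mulrz_suml -big_split /=; apply: eq_bigr => j _.
by rewrite mulrzDr !mulrzA.
Qed.

Lemma rational_spanN a : rational_span a -> rational_span (- a).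
Proof.
move=> [d d0 [m Hm]]; exists d => //; exists (fun j => - m j).
rewrite mulNrz Hm -sumrN; apply: eq_bigr => j _.
by rewrite mulrNz.
Qed.

Lemma rational_spanZ a d : rational_span a -> rational_span (a *~ d).
Proof.
move=> [e e0 [m Hm]]; exists e => //; exists (fun j => m j * d).
rewrite -mulrzA mulrC mulrzA Hm mulrz_suml; apply: eq_bigr => j _.
by rewrite mulrzA.
Qed.

Lemma rational_span_div a d : d != 0 -> rational_span (a *~ d) -> rational_span a.
Proof.
move=> d0 [e e0 [m Hm]]; exists (d * e); first by rewrite mulf_neq0.
by exists m; rewrite mulrzA.
Qed.

Lemma rational_span_gen j : rational_span (g j).
Proof.
exists 1 => //; exists (fun k => (k == j)%:R).
rewrite (bigD1 j) //= eqxx mulr1z big1 ?addr0 // => k /negPf->.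
by rewrite mulr0z.
Qed.

Lemma rational_span_sum (I : finType) (F : I -> Z) :
  (forall i, rational_span (F i)) -> rational_span (\sum_i F i).
Proof.
by move=> HF; apply: big_ind => //; [apply: rational_span0|apply: rational_spanD].
Qed.

(** Clearing denominators turns a rational linear relation between the rows of
coefficients, which exists as soon as there are more rows than columns, into an
integral relation between the [a i]. *)
Lemma rational_span_rank s (a : 'I_s -> Z) :
  (forall i, rational_span (a i)) ->
  (forall m : 'I_s -> int, \sum_(i < s) a i *~ m i = 0 -> forall i, m i = 0) ->
  (s <= #|J|)%N.
Proof.
move=> Ha indep; rewrite leqNgt; apply/negP => lt_J_s.
have [d Hd] := choice (fun i => let: ex_intro2 d d0 H := Ha i in
                        ex_intro (fun d => d != 0 /\ _) d (conj d0 H)).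
have [M HM] := choice (fun i => proj2 (Hd i)).
pose A : 'M[rat]_(s, #|J|) := \matrix_(i, k) (M i (enum_val k))%:~R.
have /rowV0Pn [v /sub_kermxP vA v0] : kermx A != 0.
  by rewrite kermx_eq0 /row_free neq_ltn (leq_ltn_trans (rank_leq_col A)).
pose c : int := \prod_i denq (v 0 i).
have c0 : c != 0 by apply/prodf_neq0 => i _; apply: denq_neq0.
have [w Hw] : exists w : 'I_s -> int, forall i, (w i)%:~R = v 0 i * c%:~R.
  suff /choice [w Hw] : forall i, exists x : int, x%:~R = v 0 i * c%:~R.
    by exists w.
  move=> i.
  exists (numq (v 0 i) * \prod_(j | j != i) denq (v 0 j)).
  by rewrite /c [in RHS](bigD1 i) //= !intrM mulrA -numqE.
have Hw0 i : d i * w i = 0.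
  move: i; apply: indep.
  under eq_bigr => i _ do rewrite mulrzA HM mulrz_suml.
  rewrite exchange_big /= big1 // => j _.
  under eq_bigr => i _ do rewrite -mulrzA.
  rewrite -mulrz_sumr; suff -> : \sum_i M i j * w i = 0 by rewrite mulr0z.
  apply: (@intr_inj rat); rewrite rmorph_sum /=.
  have /rowP/(_ (enum_rank j)) := vA; rewrite !mxE => H.
  under eq_bigr => i _.
    rewrite intrM Hw mulrA [_ * v 0 i]mulrC.
  over.
  rewrite -mulr_suml -[RHS](mul0r c%:~R) -[X in _ = X * _]H.
  by congr (_ * _); apply: eq_bigr => i _; rewrite !mxE enum_rankK.
move/negP: v0; apply; apply/eqP/rowP => i; rewrite mxE.
have /eqP := Hw0 i; rewrite mulf_eq0 (negPf (proj1 (Hd i))) /= => /eqP wi.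
have /esym/eqP := Hw i; rewrite wi mulf_eq0 intr_eq0 (negPf c0) orbF.
by move/eqP.
Qed.

End RationalSpan.

Lemma rational_span_trans (Z : zmodType) (I J : finType)
    (f : I -> Z) (g : J -> Z) z :
  (forall i, rational_span g (f i)) -> rational_span f z -> rational_span g z.
Proof.
move=> Hf [d d0 [m Hm]]; apply: (rational_span_div d0); rewrite Hm.
by apply: rational_span_sum => i; apply: rational_spanZ.
Qed.

(** * The free group and the transport of its basis of degree 3 *)

Section FreeUniversal.
Variables (n : nat) (G : groupType) (x : 'I_n -> G).

Lemma free_eval1 : free_eval x 1 = 1.
Proof. by rewrite /free_eval big_nil. Qed.

Lemma free_evalM : {morph free_eval x : u v / u * v}.
Proof.
move=> u v; rewrite /free_eval /=.
elim: (free_word u) => [|a w IH] /=; first by rewrite big_nil mul1g.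
rewrite big_cons -mulgA -IH; case: (foldr _ _ _) => [|b t] /=.
  by rewrite big_seq1 big_nil mulg1.
case: eqP => [->|_]; rewrite ?big_cons //= mulgA.
by case: a => i [] /=; rewrite ?mulgV ?mulVg mul1g.
Qed.

HB.instance Definition _ := isUMagmaMorphism.Build (free_group n) G (free_eval x)
  (conj free_eval1 free_evalM).

Lemma free_eval_gen i : free_eval x (free_gen i) = x i.
Proof. by rewrite /free_eval big_seq1. Qed.

End FreeUniversal.

Lemma free_gen_generate n (g : free_group n) :
  exists u, free_eval (@free_gen n) u = g.
Proof.
exists g; apply: val_inj; case: g => w rw; rewrite /free_eval /=.
elim: w rw => [|a w IH] rw; first by rewrite big_nil.
rewrite big_cons -[RHS](reduced_consE rw) -[in RHS](IH (reduced_behead rw)).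
by case: a {rw} => i [].
Qed.

Section RankThree.
Local Open Scope classical_set_scope.
Variable G : groupType.

(** For finitely generated [G] the triple commutators of the generators bound
the size of independent families, so a largest one exists. Adding any [u] to it
creates a relation, in which the coefficient of [u] cannot vanish. *)
Lemma lcs_rank3_basis n (x : 'I_n -> G) :
  (forall g : G, exists u, free_eval x u = g) ->
  exists2 a : 'I_(lcs_rank G 3) -> G, forall i, lower_central 3 (a i) &
    forall u, lower_central 3 u -> exists2 m0 : int, m0 != 0%R &
      exists m : 'I_(lcs_rank G 3) -> int,
      (gr3 u *~ m0 + \sum_i gr3 (a i) *~ m i = 0)%R.
Proof.
move=> gen_x.
pose indep r := exists a : 'I_r -> G,
  (forall i, lower_central 3 (a i)) /\ independent_mod (lower_central 4) a.
have bound r : indep r -> (r <= #|{: 'I_n * 'I_n * 'I_n}|)%N.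
  move=> [a [Ha /independent_mod_lcs4 indep_a]].
  pose g (ijk : 'I_n * 'I_n * 'I_n) := triple3 (x ijk.1.1) (x ijk.1.2) (x ijk.2).
  apply: (rational_span_rank (g := g)) (indep_a Ha) => i.
  apply: (gr3_generated gen_x) (Ha i).
  - exact: rational_span0.
  - exact: rational_spanD.
  - exact: rational_spanN.
  by move=> j k l; apply: (rational_span_gen g (j, k, l)).
have ex0 : exists r, `[< indep r >].
  exists 0%N; apply/asboolP; have nil : 'I_0 -> G by case.
  by exists nil; split=> [[]//|m _ []].
have boundb r : `[< indep r >] -> (r <= #|{: 'I_n * 'I_n * 'I_n}|)%N.
  by move/asboolP; apply: bound.
have rank_G :
    is_quotient_rank (@lower_central G 3) (lower_central 4) (lcs_rank G 3).
  pose R := [set r | is_quotient_rank (@lower_central G 3) (lower_central 4) r].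
  suff exR : exists r, R r by exact: (xgetPex 0%N exR).
  have [r /asboolP Hr max_r] := ex_maxnP ex0 boundb.
  exists r; split=> // s a Ha ind_a; apply: max_r; apply/asboolP.
  by exists a.
have [[a [Ha ind_a]] max_r] := rank_G.
exists a => // u Hu.
pose b (i : 'I_(lcs_rank G 3).+1) := if unlift ord0 i is Some j then a j else u.
have Hb i : lower_central 3 (b i) by rewrite /b; case: unliftP.
have : ~ independent_mod (lower_central 4) b.
  by move=> /(max_r _ _ Hb); rewrite ltnn.
rewrite independent_mod_lcs4 //.
move=> /existsNP [m /not_implyP [Hm /existsNP [i Hi]]].
move: Hm; rewrite big_ord_recl /b unlift_none => Hm.
have {}Hm : (gr3 u *~ m ord0 +
    \sum_(j < lcs_rank G 3) gr3 (a j) *~ m (lift ord0 j) = 0)%R.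
  by rewrite -[RHS]Hm; congr (_ + _)%R; apply: eq_bigr => j _; rewrite liftK.
exists (m ord0); last by exists (fun j => m (lift ord0 j)).
apply/eqP => m0; apply: Hi; case: (unliftP ord0 i) => [j ->|-> //].
move: j; apply: (proj1 (independent_mod_lcs4 Ha) ind_a).
by move: Hm; rewrite m0 mulr0z add0r.
Qed.

End RankThree.

Lemma gmulf_expgz (G H : groupType) (f : UMagmaMorphism.type G H) a m :
  f (expgz a m) = expgz (f a) m.
Proof. by case: m => k /=; [apply: gmulfXn|apply: gmulfXVn]. Qed.

Lemma gr3_morph (G H : groupType) (f : UMagmaMorphism.type G H)
    r (a : 'I_r -> G) (m : 'I_r -> int) :
  (forall i, lower_central 3 (a i)) ->
  (\sum_i gr3 (a i) *~ m i = 0)%R -> (\sum_i gr3 (f (a i)) *~ m i = 0)%R.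
Proof.
move=> Ha; have Hfa i : lower_central 3 (f (a i)) by apply: lower_central_morph.
have [Hp <-] := gr3_prod m Ha; have [Hfp <-] := gr3_prod m Hfa.
move/(gr3_eq0 Hp)/(lower_central_morph f) => L; apply/(gr3_eq0 Hfp).
by move: L; rewrite gmulf_prod; under eq_bigr => i _ do rewrite gmulf_expgz.
Qed.

(** The images of a maximal independent family of the free group on [m] letters,
under the morphism that sends the letters to [y]: a relation modulo [F_4] between
that family and a bracket of letters is sent to a relation modulo [G_4]. *)
Lemma free_rank_local (G : groupType) m (y : 'I_m -> G) :
  exists b : 'I_(free_lcs_rank 3 m) -> center (quotient_group (lcs4 G)),
    forall i j k, rational_span b (triple3 (y i) (y j) (y k)).
Proof.
have [a Ha basis_a] := lcs_rank3_basis (@free_gen_generate m).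
exists (fun l => gr3 (free_eval y (a l))) => i j k.
pose u := [~ [~ free_gen i, free_gen j], free_gen k].
have Hu : lower_central 3 u by apply: lower_central_triple.
have [m0 m0N0 [c Hc]] := basis_a u Hu.
pose b (l : 'I_(free_lcs_rank 3 m).+1) :=
  if unlift ord0 l is Some l' then a l' else u.
pose d (l : 'I_(free_lcs_rank 3 m).+1) :=
  if unlift ord0 l is Some l' then c l' else m0.
have Hb l : lower_central 3 (b l) by rewrite /b; case: unliftP.
have bd : (\sum_l gr3 (b l) *~ d l = 0)%R.
  rewrite big_ord_recl /b /d unlift_none -[RHS]Hc; congr (_ + _)%R.
  by apply: eq_bigr => l _; rewrite liftK.
have := @gr3_morph _ _ (free_eval y) _ b d Hb bd.
rewrite big_ord_recl {1}/b {1}/d unlift_none => H.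
exists m0 => //; exists (fun l => (- c l)%R).
under eq_bigr => l _ do rewrite mulrNz.
rewrite sumrN; apply/eqP; rewrite -addr_eq0; apply/eqP; rewrite -[RHS]H.
congr (_ + _)%R; first by rewrite triple3E /u !gmulfR /= !free_eval_gen.
by apply: eq_bigr => l _; rewrite /b /d liftK.
Qed.

(** * Two triangles with a common edge in a graph *)

Section GraphCycles.
Local Open Scope ring_scope.
Variables (T : finType) (e : rel T).
Hypotheses (sym_e : symmetric e) (irr_e : irreflexive e).

(** The oriented edge from [u] to [v] as a chain: each edge is stored with only
one of its orientations, and the other one is read with a minus sign. *)
Definition edge_row (u v : T) : 'rV[rat]_#|oriented_edges e| :=
  \row_k ((enum_val k == (u, v))%:R - (enum_val k == (v, u))%:R).

(** Pairing with an antisymmetric function does not depend on the orientation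
that is stored. *)
Lemma edge_rowE (F : T * T -> rat) u v :
  e u v -> F (v, u) = - F (u, v) ->
  \sum_k edge_row u v 0 k * F (enum_val k) = F (u, v).
Proof.
move=> euv Fvu.
have pick_term w : \sum_(x in oriented_edges e) (x == w)%:R * F x =
    (w \in oriented_edges e)%:R * F w.
  case: (boolP (w \in _)) => [w_in|w_out].
    rewrite (bigD1 w) //= eqxx big1 ?addr0 // => x /andP[_ /negPf->].
    by rewrite mul0r.
  rewrite mul0r big1 // => x x_in; case: eqP => [xw|_]; last exact: mul0r.
  by rewrite -xw x_in in w_out.
under eq_bigr => k _ do rewrite mxE.
pose H (x : T * T) := ((x == (u, v))%:R - (x == (v, u))%:R) * F x.
rewrite -(big_enum_val H) /H /=.
under eq_bigr => x _ do rewrite mulrBl.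
rewrite sumrB !pick_term Fvu !inE /= (sym_e v u) euv /=.
case: ltngtP => [_|_|/val_inj/enum_rank_inj uv].
- by rewrite mul1r mul0r subr0.
- by rewrite mul1r mul0r sub0r opprK.
- by rewrite uv irr_e in euv.
Qed.

Lemma edge_row_boundary u v : e u v ->
  edge_row u v *m boundary_mx e =
  \row_j ((enum_val j == v)%:R - (enum_val j == u)%:R).
Proof.
move=> euv; apply/rowP => j; rewrite !mxE.
under eq_bigr => k _ do rewrite [boundary_mx e k j]mxE.
pose F (x : T * T) : rat := (enum_val j == x.2)%:R - (enum_val j == x.1)%:R.
by apply: (@edge_rowE F) => //; rewrite /F /= opprB.
Qed.

Definition triangle_row (p q r : T) := edge_row p q + edge_row q r + edge_row r p.

Lemma triangle_row_cycle p q r : e p q -> e q r -> e r p ->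
  triangle_row p q r *m boundary_mx e = 0.
Proof.
move=> pq qr rp; rewrite !mulmxDl !edge_row_boundary //.
apply/rowP => j; rewrite !mxE.
rewrite [X in X + _]addrC [X in X + _]addrA subrK.
by rewrite addrA subrK subrr.
Qed.

Lemma edge_row_dot a b u v : e a b ->
  edge_row a b *m (edge_row u v)^T =
  (((a, b) == (u, v))%:R - ((a, b) == (v, u))%:R)%:M.
Proof.
move=> ab; apply/matrixP => i j; rewrite !mxE !ord1 eqxx mulr1n.
under eq_bigr => k _ do rewrite [_^T _ _]mxE [edge_row u v _ _]mxE.
pose F (x : T * T) : rat := (x == (u, v))%:R - (x == (v, u))%:R.
apply: (@edge_rowE F) => //; rewrite /F /= opprB.
by rewrite !xpair_eqE [(b == u) && _]andbC [(b == v) && _]andbC.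
Qed.

(** The cycles p q r and p q s are independent because the edge r p occurs only
in the first and the edge s p only in the second: [C] reads off these two
coefficients. *)
Lemma diamond_betti p q r s : e p q -> e p r -> e q r -> e p s -> e q s ->
  r != s -> (2 <= graph_betti1 e)%N.
Proof.
move=> pq pr qr ps qs rs.
have neq u v : e u v -> (u == v) = false.
  by move=> uv; apply/eqP => E; rewrite E irr_e in uv.
have sneq u v : e u v -> (v == u) = false by rewrite sym_e; apply: neq.
have rp : e r p by rewrite sym_e.
have sp : e s p by rewrite sym_e.
have rs' := negPf rs; have sr' : (s == r) = false by rewrite eq_sym.
pose M := col_mx (triangle_row p q r) (triangle_row p q s).
pose C := row_mx (edge_row r p)^T (edge_row s p)^T.
have free_M : row_free M.
  apply/row_freeP; exists C.
  rewrite mul_col_row !mulmxDl !edge_row_dot // !xpair_eqE.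
  rewrite !eqxx rs' sr'.
  rewrite !(neq _ _ pq, neq _ _ pr, neq _ _ qr, neq _ _ ps, neq _ _ qs).
  rewrite !(sneq _ _ pq, sneq _ _ pr, sneq _ _ qr, sneq _ _ ps, sneq _ _ qs).
  by rewrite ?andbF ?subr0 ?subrr ?raddf0 ?add0r ?addr0 -?scalar_mx_block.
have := mxrankS (_ : (M <= kermx (boundary_mx e))%MS).
rewrite (eqP free_M); apply; apply/sub_kermxP.
by rewrite mul_col_mx !triangle_row_cycle ?col_mx0.
Qed.

End GraphCycles.

(** * Vanishing of the non-local triple brackets *)

Section Vanishing.
Local Open Scope ring_scope.
Variables (X L : finType) (line : L -> {set X}).
Hypothesis line_pair : forall i j, i != j ->
  exists p, (i \in line p) && (j \in line p).
Hypothesis line_inter : forall p q i j, p != q -> i != j ->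
  i \in line p -> j \in line p -> i \in line q -> j \in line q -> False.

Definition multiple (p : L) := (3 <= #|line p|)%N.
Definition meet (p q : L) := [exists i, (i \in line p) && (i \in line q)].

Hypothesis no_diamond : forall p q r s,
  multiple p -> multiple q -> multiple r -> multiple s ->
  uniq [:: p; q; r; s] ->
  meet p q -> meet p r -> meet q r -> meet p s -> meet q s -> False.

Variables (Z : zmodType) (t : X -> X -> X -> Z).
Hypothesis t_alt : forall i k, t i i k = 0.
Hypothesis tC : forall i j k, t j i k = - t i j k.
Hypothesis t_Jacobi : forall i j k, t i j k + t j k i + t k i j = 0.
Hypothesis t_rel : forall p i k, i \in line p -> \sum_(j in line p) t i j k = 0.

Lemma tJ i j k : t i j k = - t j k i - t k i j.
Proof. by apply/eqP; rewrite -opprD -addr_eq0 addrA t_Jacobi. Qed.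

Lemma meetI i p q : i \in line p -> i \in line q -> meet p q.
Proof. by move=> ip iq; apply/existsP; exists i; rewrite ip iq. Qed.

(** On a line with two points only, the relation has a single non-zero term. *)
Lemma t_double p i j k :
  ~~ multiple p -> i \in line p -> j \in line p -> t i j k = 0.
Proof.
rewrite -leqNgt => le_p ip jp; have [->|ij] := eqVneq i j; first exact: t_alt.
have := t_rel k ip; rewrite (bigD1 i) //= t_alt add0r (bigD1 j) /=; last first.
  by rewrite jp eq_sym ij.
rewrite big_pred0 ?addr0 // => l; apply: contraTF le_p => /andP[/andP[lp li] lj].
rewrite -ltnNge -/(2 < _)%N; apply: leq_trans (_ : #|[set i; j; l]| <= _)%N.
  by rewrite finset.setUC cardsU1 !inE negb_or li lj cards2 ij.
apply/subset_leq_card/fintype.subsetP => x; rewrite !inE.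
by move=> /orP[/orP[]|] /eqP->.
Qed.

(** Two points that are not linked have a vanishing bracket, because the line
through them has at most two points. *)
Definition linked (i j : X) :=
  [exists q, [&& multiple q, i \in line q & j \in line q]].

Lemma linkedP i j : reflect
  (exists q, [/\ multiple q, i \in line q & j \in line q]) (linked i j).
Proof. by apply: (iffP existsP) => -[q /and3P]; exists q. Qed.

Lemma t_unlinked i j k : ~~ linked i j -> t i j k = 0.
Proof.
move=> nij; have [->|ij] := eqVneq i j; first exact: t_alt.
have [q /andP[iq jq]] := line_pair ij; apply: (t_double _ (p := q)) => //.
by apply: contra nij => mq; apply/linkedP; exists q.
Qed.

(** By the Jacobi identity, since [c] commutes with both [i] and [j]. *)
Lemma t_both_unlinked i j c : ~~ linked i c -> ~~ linked j c -> t i j c = 0.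
Proof.
move=> ic jc; rewrite tJ (t_unlinked _ jc) -tC (t_unlinked _ ic).
by rewrite oppr0 addr0.
Qed.

(** If a single point [k] of the line [p] is linked to [c], the sum relation
expresses every bracket with [k] through brackets of points not linked to
[c]. *)
Lemma t_except p c k i j : (forall i, i \in line p -> i != k -> ~~ linked i c) ->
  k \in line p -> i \in line p -> j \in line p -> t i j c = 0.
Proof.
move=> unl kp.
have tk i' : i' \in line p -> t i' k c = 0.
  move=> ip; have [->|ik] := eqVneq i' k; first exact: t_alt.
  have := t_rel c ip; rewrite (bigD1 k) //= big1 ?addr0 // => l /andP[lp lk].
  by apply: t_both_unlinked; apply: unl.
move=> ip jp; have [->|jk] := eqVneq j k; first exact: tk.
have [->|ik] := eqVneq i k; first by rewrite tC tk ?oppr0.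
by apply: t_both_unlinked; apply: unl.
Qed.

(** The critical case: p, q, r form a triangle with vertices k, l and c. The sum
y of the points of q commutes with k. Computing [[i, k], y] term by term gives
[[i, k], k] + [[i, k], c], because a point of q other than k and c is linked to
no point of p but k ([t_except]). The Jacobi identity gives [[i, y], k] instead,
which is [[i, k], k] because k is the only point of q linked to i. Any further
link would produce a diamond. *)
Lemma t_triangle p q r c k l i :
  multiple p -> multiple q -> multiple r -> q != r ->
  c \notin line p -> k \in line p -> k \in line q ->
  l \in line p -> l \in line r -> c \in line q -> c \in line r -> k != l ->
  i \in line p -> i != k -> i != l -> t i k c = 0.
Proof.
move=> mp mq mr qr cp kp kq lp lr cq cr kl ip ik il.
have notin_neq x a b : x \in line a -> x \notin line b -> a != b.
  by move=> xa xb; apply: contraNneq xb => <-.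
have pq : p != q by rewrite eq_sym; apply: (notin_neq c).
have pr : p != r by rewrite eq_sym; apply: (notin_neq c).
(* Else that line would form a diamond with p, q and r. *)
have ordinary x y : x \in line p -> x != k -> y \in line q -> y != k ->
    (y \in line r -> x \notin line r) -> ~~ linked x y.
  move=> xp xk yq yk nr; apply/negP => /linkedP [s [ms xs ys]].
  have sp : s != p.
    by apply: contraTneq ys => ->; apply/negP => yp; apply: (line_inter pq yk).
  have sq : s != q.
    by apply: contraTneq xs => ->; apply/negP => xq; apply: (line_inter pq xk).
  have sr : s != r.
    by apply/eqP => sr; rewrite sr in xs ys; move: (nr ys); rewrite xs.
  apply: (no_diamond mp mq mr ms).
  - by rewrite /= !inE !negb_or pq pr qr ![_ == s]eq_sym sp sq sr.
  - exact: (meetI kp kq).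
  - exact: (meetI lp lr).
  - exact: (meetI cq cr).
  - exact: (meetI xp xs).
  - exact: (meetI yq ys).
have ir : i \notin line r.
  by apply/negP => ir; apply: (line_inter pr il ip lp ir lr).
have t_ikd d : d \in line q -> d != k -> d != c -> t i k d = 0.
  move=> dq dk dc; apply: (@t_except p d k) => // x xp xk.
  apply: ordinary => // dr.
  by case: (line_inter qr dc dq cq dr cr).
have t_idk d : d \in line q -> d != k -> t i d k = 0.
  by move=> dq dk; apply/t_unlinked/ordinary.
have ck : c != k by apply: contraNneq cp => ->.
have sum1 : \sum_(d in line q) t i k d = t i k k + t i k c.
  rewrite (bigD1 k) //= (bigD1 c) /=; last by rewrite cq ck.
  by rewrite big1 ?addr0 // => d /andP[/andP[dq dk] dc]; apply: t_ikd.
have sum2 : \sum_(d in line q) t i k d = t i k k.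
  transitivity (\sum_(d in line q) (- t k d i + t i d k)).
    by apply: eq_bigr => d _; rewrite tJ (tC i d k) opprK.
  rewrite big_split /= sumrN t_rel // oppr0 add0r (bigD1 k) //=.
  by rewrite big1 ?addr0 // => d /andP[dq dk]; apply: t_idk.
by move/eqP: sum1; rewrite sum2 -subr_eq0 opprD addNKr oppr_eq0 => /eqP.
Qed.

(** The number of points of [p] linked to [c] is zero, one or two: a third one
would give a diamond. With two of them, the two lines through [c] form a triangle
with [p]. *)
Lemma t_nonlocal p c i j :
  c \notin line p -> i \in line p -> j \in line p -> t i j c = 0.
Proof.
move=> cp.
case: (boolP (multiple p)) => [mp|dp]; last first.
  by move=> ip jp; apply: t_double dp ip jp.
case: (boolP [exists k in line p, linked k c])
    => [/exists_inP[k kp kc]|none]; last first.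
  have unl x : x \in line p -> ~~ linked x c.
    by move=> xp; apply: contra none => xc; apply/exists_inP; exists x.
  by move=> ip jp; apply: t_both_unlinked; apply: unl.
case: (boolP [exists l in line p, (l != k) && linked l c])
    => [/exists_inP[l lp /andP[lk lc]]|none]; last first.
  apply: (t_except _ kp) => x xp xk; apply: contra none => xc.
  by apply/exists_inP; exists x; rewrite ?xk.
move/linkedP: (kc) => [q [mq kq cq]]; move/linkedP: (lc) => [r [mr lr cr]].
have notin_neq x a b : x \in line a -> x \notin line b -> a != b.
  by move=> xa xb; apply: contraNneq xb => <-.
have qp : q != p by apply: (notin_neq c).
have rp : r != p by apply: (notin_neq c).
have qr : q != r.
  by apply/eqP => E; rewrite -E in lr; apply: (line_inter qp lk lr kq lp kp).
have kl : k != l by rewrite eq_sym.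
have t_k i' : i' \in line p -> i' != k -> i' != l -> t i' k c = 0.
  by apply: (t_triangle mp mq mr qr cp kp kq lp lr cq cr kl).
have t_l i' : i' \in line p -> i' != k -> i' != l -> t i' l c = 0.
  move=> ip ik il; rewrite eq_sym in qr.
  exact: (t_triangle mp mr mq qr cp lp lr kp kq cr cq lk).
have t_kl : t k l c = 0.
  have := t_rel c kp; rewrite (bigD1 l) //= big1 ?addr0 // => x /andP[xp xl].
  have [->|xk] := eqVneq x k; first exact: t_alt.
  by rewrite tC t_k ?oppr0.
have unl x : x \in line p -> x != k -> x != l -> ~~ linked x c.
  move=> xp xk xl; apply/negP => /linkedP [s [ms xs cs]].
  have sp : s != p by apply: (notin_neq c).
  have sq : s != q.
    by apply/eqP => E; rewrite E in xs; apply: (line_inter qp xk xs kq xp kp).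
  have sr : s != r.
    by apply/eqP => E; rewrite E in xs; apply: (line_inter rp xl xs lr xp lp).
  apply: (no_diamond mp mq mr ms).
  - rewrite /= !inE !negb_or [p == q]eq_sym [p == r]eq_sym qp rp qr.
    by rewrite ![_ == s]eq_sym sp sq sr.
  - exact: (meetI kp kq).
  - exact: (meetI lp lr).
  - exact: (meetI cq cr).
  - exact: (meetI xp xs).
  - exact: (meetI cq cs).
have t_gen x y :
    x \in line p -> y \in line p -> x != k -> x != l -> t x y c = 0.
  move=> xp yp xk xl; have [->|yk] := eqVneq y k; first exact: t_k.
  have [->|yl] := eqVneq y l; first exact: t_l.
  by apply: t_both_unlinked; apply: unl.
move=> ip jp; case: (boolP ((i != k) && (i != l))) => [/andP[ik il]|ikl].
  exact: t_gen.
case: (boolP ((j != k) && (j != l))) => [/andP[jk jl]|jkl].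
  by rewrite tC t_gen ?oppr0.
move: ikl jkl; rewrite !negb_and !negbK.
by move=> /orP[]/eqP-> /orP[]/eqP->; rewrite ?t_alt // tC t_kl oppr0.
Qed.

End Vanishing.

(** * The graded relations of a conjugation-free group *)

(** The product X of the word is x_i W for the rotation that starts at i and
W x_i for the next one, so that x_i X = x_i W x_i = X x_i. *)
Lemma rot_product_commute (G : groupType) (I : eqType) (x : I -> G) (s : seq I) :
  (forall k, (k < size s)%N ->
     \prod_(i <- rot k s) x i = \prod_(i <- s) x i) ->
  forall i, i \in s -> commute (x i) (\prod_(j <- s) x j).
Proof.
move=> rot_s i /splitPr def_s; case: def_s rot_s => s1 s2 rot_s.
set X := \prod_(j <- _) _ in rot_s *.
have X1 : x i * \prod_(j <- s2 ++ s1) x j = X.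
  rewrite -(rot_s (size s1)) ?rot_size_cat ?big_cons //.
  by rewrite size_cat /= -addSnnS leq_addr.
have X2 : \prod_(j <- s2 ++ s1) x j * x i = X.
  transitivity (\prod_(j <- rot (size s1).+1 (s1 ++ i :: s2)) x j).
    rewrite -cat_rcons -(size_rcons s1 i) rot_size_cat -cats1 catA.
    by rewrite [RHS]big_cat big_seq1.
  case: (ltnP (size s1).+1 (size (s1 ++ i :: s2))) => [/rot_s //|le_s].
  by rewrite rot_oversize.
by rewrite /commute -{1}X2 mulgA X1.
Qed.

Section Presentation.
Variables (G : groupType) (P : conj_free_presentation G).
Notation x := (cf_gen (c := P)).
Notation supp := (cf_support (c := P)).

Lemma cf_rotation p k :
  let s := rev (enum (supp p)) in (k < size (enum (supp p)))%N ->
  \prod_(i <- rot k s) x i = \prod_(i <- s) x i.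
Proof.
move=> s lt_k.
have free_prod t : free_eval x (\prod_(i <- t) free_gen i) = \prod_(i <- t) x i.
  by rewrite gmulf_prod; apply: eq_bigr => i _; apply: free_eval_gen.
have : free_eval x
    (\prod_(i <- s) free_gen i / \prod_(i <- rot k s) free_gen i) = 1.
  apply: (proj2 (cf_relations _)); apply: sub_gen_smallest; exists p => //.
  by exists k => //; rewrite size_rev.
by rewrite gmulfF /= !free_prod => /divg1_eq.
Qed.

Definition cf_triple i j k := triple3 (x i) (x j) (x k).

Lemma cf_triple_rel p i k : i \in supp p ->
  (\sum_(j in supp p) cf_triple i j k = 0)%R.
Proof.
move=> ip; set s := rev (enum (supp p)).
have comm_i : commute (x i) (\prod_(j <- s) x j).
  apply: rot_product_commute; last by rewrite mem_rev mem_enum.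
  by move=> l; rewrite size_rev; apply: cf_rotation.
have -> : (\sum_(j in supp p) cf_triple i j k = \sum_(j <- s) cf_triple i j k)%R.
  by rewrite -big_enum; apply/perm_big; rewrite perm_sym perm_rev.
transitivity (triple3 (x i) (\prod_(j <- s) x j) (x k)); last first.
  rewrite triple3E; move/commgP/eqP: comm_i => ->.
  by rewrite comm1g gr3_1.
elim: s {comm_i} => [|j s IH].
  by rewrite !big_nil /triple3 [qmk _ 1]gmulf1 triple_1m.
by rewrite !big_cons IH /triple3 qmkM tripleDm.
Qed.

Lemma cf_triple_alt i k : cf_triple i i k = 0%R.
Proof. exact: triple_alt. Qed.

Lemma cf_tripleC i j k : cf_triple j i k = (- cf_triple i j k)%R.
Proof. exact: tripleC. Qed.

Lemma cf_triple_Jacobi i j k :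
  (cf_triple i j k + cf_triple j k i + cf_triple k i j = 0)%R.
Proof. exact: triple_Jacobi. Qed.

Lemma cf_inter_uniq p q i j : p != q -> i != j ->
  i \in supp p -> j \in supp p -> i \in supp q -> j \in supp q -> False.
Proof.
move=> pq ij ip jp iq jq.
suff : (2 <= #|supp p :&: supp q|)%N by rewrite leqNgt ltnS cf_inter.
rewrite (leq_trans (_ : 2 <= #|[set i; j]|)%N) //; first by rewrite cards2 ij.
apply/subset_leq_card/fintype.subsetP => y; rewrite !inE.
by move=> /orP[] /eqP->; apply/andP.
Qed.

Lemma relation_graph_sym : symmetric (relation_graph P).
Proof. by move=> u v; rewrite /relation_graph eq_sym finset.setIC. Qed.

Lemma relation_graph_irr : irreflexive (relation_graph P).
Proof. by move=> u; rewrite /relation_graph eqxx. Qed.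

Lemma relation_graph_meet (u v : multiple_relation P) :
  u != v -> meet supp (val u) (val v) -> relation_graph P u v.
Proof.
move=> uv /existsP[i iuv]; rewrite /relation_graph uv eqn_leq cf_inter //=.
by rewrite card_gt0; apply/set0Pn; exists i; rewrite inE.
Qed.

Lemma no_diamond : (graph_betti1 (relation_graph P) <= 1)%N ->
  forall p q r s,
  multiple supp p -> multiple supp q -> multiple supp r -> multiple supp s ->
  uniq [:: p; q; r; s] ->
  meet supp p q -> meet supp p r -> meet supp q r ->
  meet supp p s -> meet supp q s -> False.
Proof.
move=> betti p q r s mp mq mr ms /=.
rewrite !inE !negb_or andbT.
move=> /and3P[/and3P[npq npr nps] /andP[nqr nqs] nrs] pq pr qr ps qs.
move: betti; rewrite leqNgt => /negP; apply.
pose vtx a (m : multiple supp a) : multiple_relation P := exist _ a m.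
by apply: (diamond_betti relation_graph_sym relation_graph_irr
    (p := vtx p mp) (q := vtx q mq) (r := vtx r mr) (s := vtx s ms)) => //;
  apply: relation_graph_meet.
Qed.

Lemma cf_triple_nonlocal : (graph_betti1 (relation_graph P) <= 1)%N ->
  forall p c i j, c \notin supp p -> i \in supp p -> j \in supp p ->
  cf_triple i j c = 0%R.
Proof.
move=> betti; apply: t_nonlocal.
- by move=> i j /cf_pair [p [Hp _]]; exists p.
- exact: cf_inter_uniq.
- exact: no_diamond.
- exact: cf_triple_alt.
- exact: cf_tripleC.
- exact: cf_triple_Jacobi.
- exact: cf_triple_rel.
Qed.

(** The sum of the generators of a relation is central in the local Lie ring, so
it can also be used in the last argument; the Jacobi identity moves it to the
middle one. *)
Lemma cf_triple_rel3 p i j : i \in supp p -> j \in supp p ->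
  (\sum_(k in supp p) cf_triple i j k = 0)%R.
Proof.
move=> ip jp.
transitivity (\sum_(k in supp p) (- cf_triple j k i + cf_triple i k j))%R.
  apply: eq_bigr => k _.
  by rewrite (tJ cf_triple_Jacobi) (cf_tripleC i k) opprK.
by rewrite big_split /= sumrN !cf_triple_rel // oppr0 addr0.
Qed.

(** Each of the three arguments can avoid one generator [i0] of the relation,
because the sum of all of them kills every bracket. The part of degree 3 is thus
an image of the one of a free group with one letter less than the length of the
relation. *)
Lemma cf_local_span p : exists b : 'I_(free_lcs_rank 3 #|supp p|.-1) -> center _,
  forall i j k, i \in supp p -> j \in supp p -> k \in supp p ->
    rational_span b (cf_triple i j k).
Proof.
have : (0 < #|supp p|)%N by apply: leq_trans (cf_length p).
rewrite card_gt0 => /set0Pn [i0 i0p].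
have cardA : #|supp p|.-1 = #|supp p :\ i0| by rewrite (cardsD1 i0) i0p.
pose e l := enum_val (cast_ord cardA l).
have [b Hb] := free_rank_local (fun l => x (e l)).
exists b.
have e_surj i : i \in supp p -> i != i0 -> exists l, i = e l.
  move=> ip i_i0; have iA : i \in supp p :\ i0 by rewrite !inE i_i0.
  exists (cast_ord (esym cardA) (enum_rank_in iA i)).
  by rewrite /e cast_ordKV enum_rankK_in.
have solve_last (F : 'I_(cf_ngens P) -> center (quotient_group (lcs4 G))) :
    (\sum_(i in supp p) F i = 0)%R ->
    (forall i, i \in supp p -> i != i0 -> rational_span b (F i)) ->
    forall i, i \in supp p -> rational_span b (F i).
  move=> sumF HF i ip; have [->|] := eqVneq i i0; last exact: HF.
  move: sumF; rewrite (bigD1 i0) //= => /eqP; rewrite addr_eq0 => /eqP ->.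
  apply: rational_spanN; apply: big_ind => [||j /andP[jp ji0]].
  - exact: rational_span0.
  - exact: rational_spanD.
  - exact: HF.
move=> i j k ip jp; move: k.
apply: (solve_last) => [|k kp ki0]; first exact: cf_triple_rel3.
move: j jp; apply: (solve_last) => [|j jp ji0]; first exact: cf_triple_rel.
move: i ip; apply: (solve_last) => [|i ip ii0].
  under eq_bigr => i _ do rewrite cf_tripleC.
  by rewrite sumrN cf_triple_rel ?oppr0.
have [[a ->] [c ->]] := conj (e_surj i ip ii0) (e_surj j jp ji0).
by have [d ->] := e_surj k kp ki0; apply: Hb.
Qed.

Lemma num_relations_sum (f : nat -> nat) :
  (\sum_(3 <= i < (cf_ngens P).+1) num_relations P i * f i =
   \sum_(v : multiple_relation P) f #|supp (val v)|)%N.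
Proof.
transitivity (\sum_(p | 3 <= #|supp p|) f #|supp p|)%N.
  transitivity (\sum_(3 <= i < (cf_ngens P).+1)
      \sum_(p | #|supp p| == i) f #|supp p|)%N.
    apply: eq_bigr => i _; rewrite /num_relations -sum_nat_const.
    by apply: eq_bigr => p /eqP->.
  rewrite (exchange_big_dep predT) //= [RHS]big_mkcond; apply: eq_bigr => p _.
  under eq_bigl => i do rewrite eq_sym.
  rewrite (big_nat1_eq _ (fun=> f #|supp p|)).
  have := max_card (supp p); rewrite card_ord => le_n.
  by rewrite ltnS le_n andbT.
rewrite (reindex_omap (val : multiple_relation P -> _) insub) => [|p mp] /=.
  by apply: eq_bigl => -[p mp] /=; rewrite mp insubT /= eqxx.
by rewrite insubT.
Qed.

End Presentation.

Theorem proposition3p9 (G : groupType) (P : conj_free_presentation G) :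
  (graph_betti1 (relation_graph P) <= 1)%N ->
  (lcs_rank G 3 <=
     \sum_(3 <= i < (cf_ngens P).+1) num_relations P i * free_lcs_rank 3 i.-1)%N.
Proof.
move=> betti.
pose r (v : multiple_relation P) := free_lcs_rank 3 #|cf_support (val v)|.-1.
rewrite (num_relations_sum P (fun i => free_lcs_rank 3 i.-1)) -/(r _).
pose b (v : multiple_relation P) := projT1 (cid (cf_local_span (val v))).
have Hb v : forall i j k, i \in cf_support (val v) -> j \in cf_support (val v) ->
    k \in cf_support (val v) -> rational_span (b v) (cf_triple i j k).
  by rewrite /b; case: cid.
pose J : finType := {v : multiple_relation P & 'I_(r v)}.
pose g (vl : J) := b (tag vl) (tagged vl).
have cardJ : #|J| = (\sum_v r v)%N.
  rewrite card_tagged sumnE big_map big_enum /=.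
  by apply: eq_bigr => v _; rewrite card_ord.
have spanJ (i j k : 'I_(cf_ngens P)) : rational_span g (cf_triple i j k).
  have [->|ij] := eqVneq i j.
    by rewrite cf_triple_alt; apply: rational_span0.
  have [p [/andP[ip jp] _]] := cf_pair ij.
  case: (boolP (multiple (cf_support (c := P)) p)) => [mp|dp]; last first.
    rewrite (t_double (@cf_triple_alt _ P) (@cf_triple_rel _ P) k dp ip jp).
    exact: rational_span0.
  case: (boolP (k \in cf_support p)) => [kp|kp]; last first.
    by rewrite (cf_triple_nonlocal betti kp ip jp); apply: rational_span0.
  pose v : multiple_relation P := exist _ p mp.
  apply: (rational_span_trans (f := b v)) => [l|]; last exact: Hb.
  exact: (rational_span_gen g (existT _ v l)).
rewrite /lcs_rank /quotient_rank; case: xgetP => // n -> [[a [Ha]]].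
move=> /independent_mod_lcs4 indep _; rewrite -cardJ.
apply: (rational_span_rank (g := g)) (indep Ha) => i.
apply: (gr3_generated (@cf_generate _ P)) (Ha i) => //.
- exact: rational_span0.
- exact: rational_spanD.
- exact: rational_spanN.
Qed.
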